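(* For every $p$-graph $H$, we have $$\mathrm{ex}(n,H,tK_r^p)=\Theta\bigl(n^{b(H)}\bigr),$$ where $b(H)=b(H,t,r)$ is the order of a largest set $U\subset V(H)$ such that no partial $(m,U)$-blowup of $H$ contains $tK_r^p$.
   Context: A $p$-graph is a $p$-uniform hypergraph. $K_r^p$ is the complete $p$-uniform hypergraph on $r$ vertices and $tK_r^p$ is the vertex-disjoint union of $t$ copies of it. A $p$-graph is $F$-free if it contains no copy of $F$ as a subhypergraph. $\mathrm{ex}(n,H,F)$ is the largest number of copies of $H$ in $F$-free $n$-vertex $p$-graphs. The asymptotic notation is as $n\to\infty$ with $H,t,r,p$ fixed. Given a $p$-graph $G$, a subset $U\subset V(G)$ and a positive integer $m$, a partial $(m,U)$-blowup of $G$ is obtained by replacing each vertex $u\in U$ with $m$ vertices $u_1,\dots,u_m$, and, for each hyperedge $E$ of $G$, if $E$ shares exactly the vertices $u^1,\dots,u^q$ with $U$, replacing $E$ with the $m^q$ hyperedges that contain, for each $i\le q$, a vertex $u^i_j$ for some $j\le m$, and each vertex in $E\setminus U$. In the definition of $b(H)$, ''no partial $(m,U)$-blowup'' means for no value of $m$. *)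

(* Defs.v *)
From HB Require Import structures.
From mathcomp Require Import all_boot all_order all_algebra.
From mathcomp Require Import boolp.

Set Implicit Arguments.
Unset Strict Implicit.
Unset Printing Implicit Defensive.

(* p-uniform hypergraphs with vertex set V; isolated vertices are allowed. *)
Record pgraph (p : nat) (V : finType) := PGraph {
  hyperedges : {set {set V}};
  _ : [forall e in hyperedges, #|e| == p]
}.

HB.instance Definition _ p V := [isSub for @hyperedges p V].
HB.instance Definition _ p V := [Finite of pgraph p V by <:].

Lemma complete_subproof p r :
  [forall e in [set e : {set 'I_r} | #|e| == p], #|e| == p].
Proof. by apply/forall_inP => e; rewrite inE. Qed.

Definition complete p r : pgraph p 'I_r := PGraph (complete_subproof p r).

Lemma disjoint_copies_subproof p (V : finType) (t : nat) (G : pgraph p V) :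
  [forall e in [set [set (i, x) | x in e]
                  | i : 'I_t, e : {set V} in hyperedges G], #|e| == p].
Proof.
apply/forall_inP => _ /imset2P[i e _ eG ->].
rewrite card_imset; last by move=> x y [].
by case: G eG => E /= /forall_inP hE /hE.
Qed.

Definition disjoint_copies p (V : finType) (t : nat) (G : pgraph p V) :
  pgraph p ('I_t * V)%type := PGraph (disjoint_copies_subproof t G).

Definition embedding p (V W : finType) (H : pgraph p V) (G : pgraph p W)
    (f : {ffun V -> W}) : bool :=
  injectiveb f && [forall e in hyperedges H, f @: e \in hyperedges G].

Definition contains p (V W : finType) (G : pgraph p W) (F : pgraph p V) : bool :=
  [exists f : {ffun V -> W}, embedding F G f].

(* A copy of H in G is a subhypergraph of G isomorphic to H, given as a pair
   (vertex set, hyperedge set); embeddings that differ by an automorphism of H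
   yield the same copy. *)
Definition copies p (V W : finType) (H : pgraph p V) (G : pgraph p W) :
    {set {set W} * {set {set W}}} :=
  [set (f @: [set: V], [set f @: (e : {set V}) | e in hyperedges H])
     | f : {ffun V -> W} & embedding H G f].

Definition ex p (V W : finType) (n : nat) (H : pgraph p V) (F : pgraph p W) :
    nat :=
  \max_(G : pgraph p 'I_n | ~~ contains G F) #|copies H G|.

(* Vertices of the partial (m, U)-blowup: m clones of each vertex of U and a
   single clone of every other vertex; tag maps a clone to its original. *)
Definition blowup_vertex (V : finType) (U : {set V}) (m : nat) : finType :=
  {v : V & 'I_(if v \in U then m else 1)}.

(* The cardinality condition forces tag to be injective on X: X contains exactly
   one clone of each vertex of the hyperedge tag @: X of G. *)
Definition blowup_edges p (V : finType) (G : pgraph p V) (U : {set V})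
    (m : nat) : {set {set blowup_vertex U m}} :=
  [set X : {set blowup_vertex U m} |
     (#|X| == p) && ([set tag x | x in X] \in hyperedges G)].

Lemma blowup_subproof p (V : finType) (G : pgraph p V) (U : {set V}) m :
  [forall e in blowup_edges G U m, #|e| == p].
Proof. by apply/forall_inP => e; rewrite inE => /andP[]. Qed.

Definition blowup p (V : finType) (G : pgraph p V) (U : {set V}) (m : nat) :
  pgraph p (blowup_vertex U m) := PGraph (blowup_subproof G U m).

Definition blowup_free p (V W : finType) (H : pgraph p V) (F : pgraph p W)
    (U : {set V}) : Prop :=
  forall m, 0 < m -> ~~ contains (blowup H U m) F.

(* The parameter b(H, t, r). It is None when no set U qualifies, i.e. when
   H itself contains t K_r^p. *)
Definition blowup_exponent p (V : finType) (H : pgraph p V) (t r : nat) :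
    option nat :=
  let good U := `[< blowup_free H (disjoint_copies t (complete p r)) U >] in
  if [exists U, good U] then Some (\max_(U : {set V} | good U) #|U|) else None.

(* n ^ b, where None stands for the exponent -oo (a maximum over no sets). *)
Definition expn_opt (n : nat) (k : option nat) : nat :=
  if k is Some k' then n ^ k' else 0.

(* Main.v *)
Require Import Defs.
From mathcomp Require Import all_boot all_order all_algebra.

(* Upper bound: among more than C * n ^ b embeddings of H in an n-vertex G there
   is a sunflower of t * r embeddings that agree off a set U of more than b
   vertices of H and are disjoint on U (cover by a maximal disjoint subfamily, fix
   one more coordinate, and repeat).  Then some blowup of H along U contains
   t K_r^p, and routing its parts through different members of the sunflower puts
   t K_r^p in G.
   Lower bound: a blowup along a largest good U with m = n %/ #|V|.+1 clones has
   at most n vertices, and its m ^ #|U| sections span distinct copies of H. *)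

Set Implicit Arguments.
Unset Strict Implicit.
Unset Printing Implicit Defensive.

(** * Sunflowers in families of injections *)

(** In the second clause [v] ranges over all of [V]: the image of [U] under [f i] misses the whole
    image of [f j], kernel included. *)
Definition sunflower (I V W : finType) (U : {set V}) (f : I -> {ffun V -> W}) :
    Prop :=
  (forall i j v, v \notin U -> f i v = f j v) /\
  (forall i j u v, i != j -> u \in U -> f i u <> f j v).

Lemma card_ffun_agree (V W : finType) (K : {set V}) (Phi : {set {ffun V -> W}}) :
  (forall f g v, f \in Phi -> g \in Phi -> v \in K -> f v = g v) ->
  #|Phi| <= #|W| ^ #|~: K|.
Proof.
move=> agree.
pose restrict (f : {ffun V -> W}) :=
  [ffun u : {v | v \in ~: K} => f (val u)].
have restrict_inj : {in Phi &, injective restrict}.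
  move=> f g fP gP /ffunP fg; apply/ffunP => v.
  have [vK|vK] := boolP (v \in K); first exact: agree.
  have vK' : v \in ~: K by rewrite inE.
  by have := fg (Sub v vK'); rewrite !ffunE SubK.
rewrite -(card_in_imset restrict_inj) (leq_trans (max_card _)) //.
by rewrite card_ffun card_sig (@eq_card _ _ (mem (~: K))).
Qed.

Lemma leq_card_bigcup (I T : finType) (A : {set I}) (B : I -> {set T}) :
  #|\bigcup_(i in A) B i| <= \sum_(i in A) #|B i|.
Proof.
elim/big_rec2: _ => [|i n X _ leXn]; first by rewrite cards0.
by rewrite cardsU (leq_trans (leq_subr _ _)) // leq_add2l.
Qed.

(** Induction on the number of coordinates outside [K], where all members already agree. Fewer than
    [C] classes, each with one more coordinate fixed, cover the family; once at most [b] coordinates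
    are free, the plain count of functions suffices. *)
Lemma sunflower_bound (I V W : finType) (b : nat) (K : {set V})
    (Phi : {set {ffun V -> W}}) :
  0 < #|W| ->
  (forall f, f \in Phi -> injective f) ->
  (forall f g v, f \in Phi -> g \in Phi -> v \in K -> f v = g v) ->
  (forall U (f : I -> {ffun V -> W}),
     (forall i, f i \in Phi) -> sunflower U f -> #|U| <= b) ->
  #|Phi| <= (#|V| * (#|V| * #|I|)).+1 ^ #|~: K| * #|W| ^ b.
Proof.
move=> W_gt0; set C := (#|V| * _).+1.
move Dd: #|~: K| => d; elim: d K Phi Dd => [|d IHd] K Phi Dd injP agree noflower.
  by rewrite mul1n (leq_trans (card_ffun_agree agree)) // Dd expn_gt0 W_gt0.
have [le_db | lt_bd] := leqP d.+1 b.
  rewrite (leq_trans (card_ffun_agree agree)) // Dd.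
  by rewrite (leq_trans (leq_pexp2l W_gt0 le_db)) // leq_pmull // expn_gt0.
pose P (S : {set {ffun V -> W}}) := (S \subset Phi) &&
  [forall f in S, forall g in S,
     (f != g) ==> [disjoint f @: (~: K) & g @: (~: K)]].
have [S] : {S | maxset P S}.
  apply: ex_maxset; exists set0; rewrite /P sub0set /=.
  by apply/forall_inP => f; rewrite inE.
move=> /maxsetP[/andP[/subsetP SP /forall_inP disjS] maxS].
have disj f g u v : f \in S -> g \in S -> f != g -> u \notin K -> v \notin K ->
    f u <> g v.
  move=> fS gS fg uK vK fu; have /forall_inP/(_ g gS)/implyP/(_ fg) := disjS f fS.
  move/pred0P/(_ (f u)); rewrite /= imset_f ?inE //= fu imset_f ?inE //.
(* With [#|I|] members, [S] would yield a sunflower on [~: K], which has more than [b] elements. *)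
have ltSI : #|S| < #|I|.
  rewrite ltnNge; apply: contraL lt_bd => leIS; rewrite -leqNgt -Dd.
  pose f i := enum_val (widen_ord leIS (enum_rank i)).
  have fS i : f i \in S by apply: enum_valP.
  apply: (noflower _ f) => [i|]; first exact: SP.
  split=> [i j v | i j u v ij]; rewrite inE ?negbK => uK.
    by apply: agree => //; apply: SP.
  have fij : f i != f j.
    apply: contra ij => /eqP/enum_val_inj/(congr1 val)/= ij.
    by apply/eqP/enum_rank_inj/val_inj.
  (* A value taken on [K] is shared by all members, so injectivity of [f i] keeps it off the
     petals. *)
  have [vK|vK] := boolP (v \in K); last exact: disj.
  rewrite (agree (f j) (f i)) ?SP // => /(injP _ (SP _ (fS i))) uv.
  by rewrite uv vK in uK.
pose hit (z : V * (V * {ffun V -> W})) := [set g in Phi | g z.1 == z.2.2 z.2.1].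
have cover : Phi \subset \bigcup_(z in setX (~: K) (setX setT S)) hit z.
  apply/subsetP => g gP.
  have [/exists_inP[f fS /exists_inP[v vK /existsP[u /eqP gvu]]] | miss] :=
    boolP [exists f in S, exists v in ~: K, exists u, g v == f u].
    by apply/bigcupP; exists (v, (u, f)); rewrite !inE ?fS ?gvu ?eqxx ?gP -?in_setC ?vK.
  have missN f u v : f \in S -> v \notin K -> g v <> f u.
    move=> fS vK gvu; case/negP: miss; apply/exists_inP; exists f => //.
    apply/exists_inP; exists v; rewrite ?inE //; apply/existsP.
    by exists u; rewrite gvu.
  (* A [g] that meets no member of [S] could be added to [S], so it lies in [S] by maximality; but
     then it meets itself at any [v] outside [K]. *)
  have gS : g \in S.
    rewrite -(maxS (g |: S)) ?setU11 ?subsetUr // /P subUset sub1set gP /=.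
    apply/andP; split; first exact/subsetP.
    apply/forall_inP => f1 /setU1P fS1; apply/forall_inP => f2 /setU1P fS2.
    apply/implyP => f12; apply/pred0P => x /=; apply/negbTE/negP => /andP[].
    move=> /imsetP[u1 uK1 ->] /imsetP[u2 uK2]; rewrite !inE in uK1 uK2.
    case: fS1 fS2 f12 => [->|fS1] [->|fS2]; first by rewrite eqxx.
    - by move=> _; apply: missN.
    - by move=> _ /esym; apply: missN.
    - by move=> f12; apply: disj.
  have /card_gt0P[v vK] : 0 < #|~: K| by rewrite Dd.
  by rewrite inE in vK; have := missN g v v gS vK.
(* All members of a class send [v] to the same [f u], so [v] joins [K]. *)
have hit_bound z : z \in setX (~: K) (setX setT S) -> #|hit z| <= C ^ d * #|W| ^ b.
  case: z => v [u f]; rewrite !inE /= => /andP[vK fS].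
  apply: (IHd (v |: K)).
  - by move: Dd; rewrite (cardsD1 v) inE vK setCU setDE setIC => -[].
  - by move=> g; rewrite inE => /andP[/injP].
  - move=> g h w; rewrite !inE /= => /andP[gP /eqP gv] /andP[hP /eqP hv].
    by case/orP=> [/eqP->|wK]; [rewrite gv hv | apply: agree].
  - move=> U F FP; apply: noflower => i.
    by have := FP i; rewrite inE => /andP[].
apply: leq_trans (subset_leq_card cover) _.
apply: leq_trans (leq_card_bigcup _ _) _.
apply: (@leq_trans (\sum_(z in setX (~: K) (setX setT S)) (C ^ d * #|W| ^ b))).
  exact: leq_sum.
rewrite sum_nat_const expnS -mulnA leq_mul2r; apply/orP; right.
rewrite !cardsX cardsT ltnW // ltnS leq_mul ?max_card //.
by rewrite leq_mul // ltnW.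
Qed.

Lemma exists_superset_card (T : finType) (A : {set T}) (k : nat) :
  #|A| <= k <= #|T| -> exists2 B : {set T}, A \subset B & #|B| = k.
Proof.
case/andP=> leAk lekT.
have {leAk} [d] := ex_intro (fun d => k = #|A| + d) _ (esym (subnKC leAk)).
elim: d A => [|d IHd] A kE; first by exists A; rewrite ?kE ?addn0.
have /card_gt0P[x xA] : 0 < #|~: A|.
  by rewrite -(ltn_add2l #|A|) addn0 cardsC (leq_trans _ lekT) // kE -addn1 leq_add2l.
rewrite inE in xA; have [|B AB cardB] := IHd (x |: A).
  by rewrite cardsU1 xA kE addSnnS.
by exists B => //; apply: subset_trans AB; apply: subsetUr.
Qed.

(** * Embeddings, copies and padding to [n] vertices *)

Section Embeddings.
Variable p : nat.
Implicit Types U V W X : finType.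

Lemma card_hyperedge V (G : pgraph p V) e : e \in hyperedges G -> #|e| = p.
Proof. by case: G => E /= /forall_inP hE /hE/eqP. Qed.

Lemma embeddingP V W (H : pgraph p V) (G : pgraph p W) (f : {ffun V -> W}) :
  reflect (injective f /\ forall e, e \in hyperedges H -> f @: e \in hyperedges G)
          (embedding H G f).
Proof.
by apply: (iffP andP) => -[/injectiveP injf edges]; split=> //;
  apply/forall_inP.
Qed.

Lemma containsP V W (G : pgraph p W) (F : pgraph p V) :
  reflect (exists f : V -> W, injective f /\
             forall e, e \in hyperedges F -> f @: e \in hyperedges G)
          (contains G F).
Proof.
apply: (iffP existsP) => [[f /embeddingP]|[f [injf edges]]]; first by exists f.
exists (finfun f); apply/embeddingP; split=> [x y|e eF]; first by rewrite !ffunE => /injf.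
by rewrite (eq_imset _ (ffunE f)) edges.
Qed.

Lemma embedding_comp V W X (H : pgraph p V) (G : pgraph p W) (K : pgraph p X) f g :
  embedding H G f -> embedding G K g -> embedding H K [ffun x => g (f x)].
Proof.
move=> /embeddingP[injf fE] /embeddingP[injg gE]; apply/embeddingP.
split=> [x y|e eH]; first by rewrite !ffunE => /injg/injf.
by rewrite (eq_imset _ (ffunE _)) imset_comp gE // fE.
Qed.

Lemma contains_trans V W X (F : pgraph p V) (G : pgraph p W) (K : pgraph p X) :
  contains K G -> contains G F -> contains K F.
Proof.
move=> /existsP[g gE] /existsP[f fE].
by apply/existsP; exists [ffun x => g (f x)]; apply: embedding_comp fE gE.
Qed.

(** An injective [f] acts injectively on pairs (vertex set, hyperedge set), so distinct copies stay
    distinct. *)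
Lemma leq_copies_embedding V W X (H : pgraph p V) (G : pgraph p W) (K : pgraph p X) f :
  embedding G K f -> #|copies H G| <= #|copies H K|.
Proof.
move=> fE; have [injf _] := embeddingP _ _ _ fE.
pose phi (c : {set W} * {set {set W}}) : {set X} * {set {set X}} :=
  (f @: c.1, [set f @: (e : {set W}) | e in c.2]).
have phi_inj : injective phi.
  move=> [A E] [A' E'] [/(imset_inj injf) -> /imset_inj -> //].
  exact: imset_inj.
rewrite -(card_imset (copies H G) phi_inj); apply/subset_leq_card/subsetP.
move=> _ /imsetP[_ /imsetP[g gE ->] ->]; rewrite inE in gE.
apply/imsetP; exists [ffun x => f (g x)]; first by rewrite inE (embedding_comp gE fE).
rewrite /phi /= -imset_comp -[in X in (_, X)]imset_comp.
congr (_, _); first by apply: eq_imset => x; rewrite ffunE.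
by apply: eq_imset => e /=; rewrite -imset_comp; apply: eq_imset => x; rewrite ffunE.
Qed.

Lemma pushforward_subproof V W (f : V -> W) (injf : injective f) (G : pgraph p V) :
  [forall e in [set f @: (e : {set V}) | e in hyperedges G], #|e| == p].
Proof.
by apply/forall_inP => _ /imsetP[e eG ->]; rewrite card_imset // (card_hyperedge eG).
Qed.

Definition pushforward V W (f : V -> W) (injf : injective f) (G : pgraph p V) :
  pgraph p W := PGraph (pushforward_subproof injf G).

(** Isolated vertices pad [G] to exactly [n] vertices. As every vertex of [F] lies in a hyperedge, a
    copy of [F] avoids the padding and pulls back to [G]. *)
Lemma leq_copies_ex V W X (n : nat) (H : pgraph p V) (G : pgraph p W) (F : pgraph p X) :
  #|W| <= n -> (forall x, exists2 e, e \in hyperedges F & x \in e) ->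
  ~~ contains G F -> #|copies H G| <= ex n H F.
Proof.
move=> leWn covF GF.
pose f (w : W) := widen_ord leWn (enum_rank w).
have injf : injective f by move=> x y /(congr1 val)/= /val_inj/enum_rank_inj.
apply: (@leq_trans #|copies H (pushforward injf G)|).
  apply: (@leq_copies_embedding _ _ _ _ _ _ (finfun f)); apply/embeddingP; split.
    by move=> x y; rewrite !ffunE => /injf.
  by move=> e eG; rewrite (eq_imset _ (ffunE f)) imset_f.
apply: (bigmax_sup (pushforward injf G)) => //.
apply: contra GF => /containsP[g [injg gE]]; apply/containsP.
have /fin_all_exists[h gh] x : exists w, g x = f w.
  have [e eF xe] := covF x; have /imsetP[e' _ ge] := gE e eF.
  have : g x \in g @: e by rewrite imset_f.
  by rewrite ge => /imsetP[w _ ->]; exists w.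
exists h; split=> [x y hxy|e eF]; first by apply: injg; rewrite !gh hxy.
have /imsetP[e' e'G] := gE e eF.
by rewrite (eq_imset _ gh) imset_comp => /(imset_inj injf) ->.
Qed.

End Embeddings.

(** * Partial blowups and their sections *)

Section Blowups.
Variables (p : nat) (V : finType) (H : pgraph p V) (U : {set V}) (m : nat).

Lemma tag_inj_blowup_edge X :
  X \in hyperedges (blowup H U m) -> {in X &, injective (@tag V _)}.
Proof.
rewrite inE => /andP[/eqP cardX tagX]; apply/imset_injP.
by rewrite cardX (card_hyperedge tagX).
Qed.

Lemma blowup_vertex_eq (x y : blowup_vertex U m) :
  tag x \notin U -> tag x = tag y -> x = y.
Proof.
case: x y => v i [w j] /= vU vw; case: w / vw j => j; congr Tagged.
by apply: val_inj; move: i j; rewrite (negbTE vU) => i j; rewrite !ord1.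
Qed.

Lemma card_blowup_vertex : 0 < m -> #|{: blowup_vertex U m}| <= #|V| * m.
Proof.
move=> m_gt0; rewrite card_tagged sumnE big_map big_enum -sum_nat_const.
by apply: leq_sum => v _; rewrite card_ord; case: ifP.
Qed.

(** A section picks one clone of every vertex. The vertex set of its copy meets each fibre of [tag]
    in the chosen clone only, so it determines the section. *)
Lemma copies_blowup : m ^ #|U| <= #|copies H (blowup H U m)|.
Proof.
pose section (s : {dffun forall v, 'I_(if v \in U then m else 1)}) :
  {ffun V -> blowup_vertex U m} := [ffun v => Tagged _ (s v)].
have tagK s v : tag (section s v) = v by rewrite ffunE.
have injs s : injective (section s) by apply: (can_inj (tagK s)).
have sE s : embedding H (blowup H U m) (section s).
  apply/embeddingP; split=> // e eH; rewrite inE card_imset // (card_hyperedge eH).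
  by rewrite eqxx -imset_comp (eq_imset _ (tagK s)) imset_id.
pose copy s := (section s @: [set: V],
  [set section s @: (e : {set V}) | e in hyperedges H]).
have copy_inj : injective copy.
  move=> s s' [eqV _]; apply/ffunP => v.
  have : section s v \in section s' @: [set: V] by rewrite -eqV imset_f.
  case/imsetP=> w _ sw; have vw := congr1 tag sw; rewrite !tagK in vw.
  by move: sw; rewrite -vw !ffunE => /eqP; rewrite eq_Tagged => /eqP.
have -> : m ^ #|U| = #|{dffun forall v, 'I_(if v \in U then m else 1)}|.
  rewrite card_dep_ffun foldrE big_map big_enum /= -prod_nat_const big_mkcond /=.
  by apply: eq_bigr => v _; rewrite card_ord.
rewrite -cardsT -(card_imset [set: _] copy_inj); apply/subset_leq_card/subsetP.
by move=> _ /imsetP[s _ ->]; apply/imsetP; exists (section s); rewrite ?inE.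
Qed.

End Blowups.

Lemma contains_blowup_set0 p (V W : finType) (H : pgraph p V) (F : pgraph p W) m :
  contains (blowup H set0 m) F -> contains H F.
Proof.
apply: contains_trans; apply/containsP; exists tag; split=> [x y xy|e].
  by apply: blowup_vertex_eq xy; rewrite inE.
by rewrite inE => /andP[].
Qed.

(** * Finding [tK_r^p] through a sunflower of embeddings *)

(** Used for pairs, which share a hyperedge when [p >= 2], and for singletons, which show that
    [tK_r^p] has no isolated vertex. *)
Lemma disjoint_copies_complete_cover p t r (A : {set 'I_r}) (i : 'I_t) :
  #|A| <= p <= r ->
  exists2 e, e \in hyperedges (disjoint_copies t (complete p r))
           & {subset A <= [pred x | (i, x) \in e]}.
Proof.
move=> leApr; have [|e /subsetP Ae cardE] := @exists_superset_card _ A p.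
  by rewrite card_ord.
exists [set (i, x) | x in e]; last by move=> x /Ae xe; rewrite inE imset_f.
by apply/imset2P; exists i e; rewrite // inE cardE.
Qed.

Lemma contains_sunflower p t r (V W : finType) (H : pgraph p V) (G : pgraph p W)
    (U : {set V}) m (f : 'I_t * 'I_r -> {ffun V -> W}) :
  0 < p <= r -> (forall i, embedding H G (f i)) -> sunflower U f ->
  contains (blowup H U m) (disjoint_copies t (complete p r)) ->
  contains G (disjoint_copies t (complete p r)).
Proof.
set F := disjoint_copies _ _.
move=> /andP[p_gt0 le_pr] fE [kernel petals] /containsP[g [injg gE]].
have x0 : 'I_r by apply: Ordinal (leq_trans p_gt0 le_pr).
(* Clones of one vertex lie in no common hyperedge, so for p >= 2 each K_r^p of
   the blowup projects injectively to H and one embedding serves all of it; for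
   p = 1 it may use several clones of a vertex, and each of its vertices gets its
   own embedding. *)
pose s (y : 'I_t * 'I_r) := (y.1, if p == 1 then y.2 else x0).
have injf i : injective (f i) by have [] := embeddingP _ _ _ (fE i).
apply/containsP; exists (fun y => f (s y) (tag (g y))); split=> [y y' fyy'|e eF].
  have [yU|yU] := boolP (tag (g y) \in U); last first.
    have [yU'|yU'] := boolP (tag (g y') \in U); last first.
      (* Off [U] all members agree and each vertex has a single clone, so the choice of member is
         immaterial. *)
      apply/injg/blowup_vertex_eq => //; apply: (injf (s y)).
      by rewrite fyy'; apply: kernel.
    have [ss|ss] := eqVneq (s y') (s y); last by case: (petals _ _ _ _ ss yU' (esym fyy')).
    by move: yU; rewrite ss in fyy'; rewrite (injf _ _ _ fyy') yU'.
  have [ss|ss] := eqVneq (s y) (s y'); last by case: (petals _ _ _ _ ss yU fyy').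
  rewrite ss in fyy'; have tagE := injf _ _ _ fyy'.
  case: y y' ss tagE {yU fyy'} => i x [i' x'] [<-]; have [_ ->|pN1 _] // := eqVneq p 1.
  (* Now [p >= 2]: the two vertices share a hyperedge, and [tag] is injective on its image. *)
  move=> tagE; have [|e eF xe] := @disjoint_copies_complete_cover p t r [set x; x'] i.
    by rewrite le_pr cards2 andbT; case: (_ != _) => //; rewrite ltn_neqAle eq_sym pN1.
  apply/injg/(tag_inj_blowup_edge (gE e eF)) => //; apply: imset_f; apply: xe;
    by rewrite !inE eqxx ?orbT.
(* A single member serves each hyperedge: it lies in one component, and is a singleton if
   [p = 1]. *)
have [c sc] : exists c, {in e, forall y, s y = c}.
  case/imset2P: eF => i e' _; rewrite inE => /eqP cardE ->; rewrite /s.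
  have [p1|_] := eqVneq p 1; last by exists (i, x0) => y /imsetP[x _ ->].
  move/eqP: cardE; rewrite p1 => /cards1P[x ->]; exists (i, x) => y /imsetP[z].
  by rewrite inE => /eqP -> ->.
have -> : [set f (s y) (tag (g y)) | y in e] = f c @: [set tag z | z in g @: e].
  by rewrite -!imset_comp; apply: eq_in_imset => y ye; rewrite /= sc.
have /embeddingP[_ ->] // := fE c.
by have := gE e eF; rewrite inE => /andP[].
Qed.

(** * Upper and lower bounds on [ex] *)

Lemma ex_leq p t r (V : finType) (H : pgraph p V) (b n : nat) :
  0 < p <= r -> 0 < n ->
  (forall U, blowup_free H (disjoint_copies t (complete p r)) U -> #|U| <= b) ->
  ex n H (disjoint_copies t (complete p r)) <=
    (#|V| * (#|V| * #|{: 'I_t * 'I_r}|)).+1 ^ #|V| * n ^ b.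
Proof.
move=> le_pr n_gt0 le_b; apply/bigmax_leqP => G GF.
(* Each copy is the image of an embedding, so it is enough to count embeddings, starting from [K]
   empty. *)
apply: leq_trans (leq_imset_card _ _) _; rewrite -cardsE.
rewrite -[in X in _ ^ X](cardsT V) -setC0 -[in X in _ * X ^ b](card_ord n).
apply: sunflower_bound => [|f|f g v _ _|U f fE flower]; rewrite ?card_ord ?inE //.
  by case/embeddingP.
apply: le_b => m _; apply: contra GF; apply: contains_sunflower le_pr _ flower.
by move=> i; have := fE i; rewrite !inE.
Qed.

Lemma expn_leq_ex p t r (V : finType) (H : pgraph p V) (U : {set V}) (n : nat) :
  0 < p <= r -> #|V| < n ->
  blowup_free H (disjoint_copies t (complete p r)) U ->
  n ^ #|U| <= (2 * #|V|.+1) ^ #|U| * ex n H (disjoint_copies t (complete p r)).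
Proof.
move=> /andP[p_gt0 le_pr] ltVn freeU; set m := n %/ #|V|.+1.
have m_gt0 : 0 < m by rewrite divn_gt0.
apply: (@leq_trans ((2 * #|V|.+1) ^ #|U| * m ^ #|U|)).
  rewrite -expnMn; have [-> // | U_gt0] := posnP #|U|.
  (* As [m >= 1], [n < (m + 1) * (#|V| + 1) <= 2 * m * (#|V| + 1)]. *)
  rewrite leq_exp2r // mulnAC (leq_trans (ltnW (ltn_ceil n (ltn0Sn #|V|)))) //.
  by rewrite leq_mul2r /= -/m mulSn mul1n -add1n leq_add2r.
rewrite leq_mul2l (leq_trans (copies_blowup H U m)) ?orbT //.
apply: leq_copies_ex (freeU m m_gt0) => [|[i x]].
  rewrite (leq_trans (card_blowup_vertex _ m_gt0)) //.
  by rewrite (leq_trans _ (leq_trunc_div n #|V|.+1)) // mulnC leq_mul2l leqnSn orbT.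
have [|e eF xe] := @disjoint_copies_complete_cover p t r [set x] i.
  by rewrite cards1 p_gt0.
by exists e => //; apply: xe; rewrite inE.
Qed.

Lemma ex_contained p (V W : finType) (n : nat) (H : pgraph p V) (F : pgraph p W) :
  contains H F -> ex n H F = 0.
Proof.
move=> HF; apply/eqP; rewrite -leqn0; apply/bigmax_leqP => G GF.
rewrite leqn0 cards_eq0; apply/eqP/setP => c; rewrite inE; apply/negbTE.
apply: contra GF => /imsetP[f fE _]; apply: contains_trans HF.
by apply/existsP; exists f; rewrite inE in fE.
Qed.

(* Passage to asymptotic notation *)
From mathcomp Require Import all_classical all_reals all_analysis.
Import Order.TTheory GRing.Theory Num.Theory.
Import numFieldNormedType.Exports.
Local Open Scope ring_scope.
Local Open Scope classical_set_scope.

(** Clearing the denominator of the lower constant [c^-1] lets both bounds be proved in [nat]. *)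
Lemma Theta_nat (R : realType) (f g : nat -> nat) (c d N : nat) :
  (0 < c)%N -> (0 < d)%N ->
  (forall n, (N <= n)%N -> (g n <= c * f n)%N) ->
  (forall n, (N <= n)%N -> (f n <= d * g n)%N) ->
  (fun n => (f n)%:R : R^o) \is 'Theta_\oo (fun n => (g n)%:R : R^o).
Proof.
move=> c_gt0 d_gt0 gf fg; apply/asboolP; exists (c%:R^-1, d%:R) => /=.
  by rewrite invr_gt0 !ltr0n c_gt0.
exists N => // n /= leNn; rewrite !ger0_norm ?ler0n //; split.
  by rewrite ler_pdivrMl ?ltr0n // -natrM ler_nat gf.
by rewrite -natrM ler_nat fg.
Qed.

Theorem theorem1p4 (R : realType) (p t r : nat)
  (p_gt0 : (0 < p)%N) (p_le_r : (p <= r)%N) (t_gt0 : (0 < t)%N)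
  (V : finType) (H : pgraph p V) :
  (fun n : nat => (ex n H (disjoint_copies t (complete p r)))%:R : R^o) \is
    'Theta_\oo (fun n : nat => (expn_opt n (blowup_exponent H t r))%:R : R^o).
Proof.
have le_pr : (0 < p <= r)%N by rewrite p_gt0.
rewrite /blowup_exponent; case: ifP => [/existsP[U0 good0] | /negbT/existsPn nogood].
  (* The exponent [#|V|] bounds [#|U|] for every good [U]; the threshold [#|V|.+1] guarantees at
     least one clone per vertex. *)
  apply: (@Theta_nat _ _ _ ((2 * #|V|.+1) ^ #|V|)
    ((#|V| * (#|V| * #|{: 'I_t * 'I_r}|)).+1 ^ #|V|) #|V|.+1) => [||n ltVn|n ltVn] /=.
  - by rewrite expn_gt0.
  - by rewrite expn_gt0.
  - pose good U := `[< blowup_free H (disjoint_copies t (complete p r)) U >].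
    have [|U /asboolP goodU bE] := @eq_bigmax_cond _ good (fun U : {set V} => #|U|).
      by apply/card_gt0P; exists U0; apply: good0.
    rewrite [X in (n ^ X)%N]bE.
    apply: leq_trans (expn_leq_ex le_pr ltVn goodU) _.
    by rewrite leq_mul2r leq_pexp2l ?max_card ?orbT.
  - apply: ex_leq => // [|U goodU]; first exact: leq_ltn_trans ltVn.
    by apply: (leq_bigmax_cond (F := fun U : {set V} => #|U|)); apply/asboolP.
(* Even the empty set is not good, so [H] contains [tK_r^p] and both functions vanish. *)
apply: (@Theta_nat _ _ _ 1 1 0) => // n _.
have HF : contains H (disjoint_copies t (complete p r)).
  apply: contrapT => /negP HF; have /asboolPn := nogood finset.set0; apply=> m _.
  by apply: contra HF; apply: contains_blowup_set0.
by rewrite ex_contained.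
Qed.
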